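(* Let $A=(S,\Sigma,\rightarrow,s_0)$ and $A'=(S',\Sigma_{\mathcal F},\rightarrow',s_0')$ be two PTSs. Then $A\preceq_m A'$ if and only if the Verifier has a sure winning strategy, from the initial vertex $v_0^{\mathcal G}$, in the stochastic masking game graph $\mathcal G_{A,A'}$ with the Boolean objective $\neg\Diamond v_{\mathrm{err}}=\{\omega_0\omega_1\cdots \text{ play}\mid \forall i\ge 0:\ \omega_i\neq v_{\mathrm{err}}\}$.
   Context: Probability: for a denumerable set $S$, a distribution is $\mu:S\to[0,1]$ with $\sum_{s}\mu(s)=1$; $\mathcal D(S)$ is the set of distributions, $\mathrm{Supp}(\mu)=\{s\mid \mu(s)>0\}$, and $\Delta_s$ is the Dirac distribution at $s$. For $\mu\in\mathcal D(S)$, $\mu'\in\mathcal D(S')$, a coupling is $w\in\mathcal D(S\times S')$ with $\sum_{t'}w(t,t')=\mu(t)$ for all $t$ and $\sum_t w(t,t')=\mu'(t')$ for all $t'$; $\Omega(\mu,\mu')$ denotes the set of couplings. For $R\subseteq S\times S'$, $\mu\,R^{\#}\,\mu'$ iff there is $w\in\Omega(\mu,\mu')$ with $\mathrm{Supp}(w)\subseteq R$. A probabilistic transition system (PTS) is $A=(S,\Sigma,\rightarrow,s_0)$ with $S$ a denumerable set of states, $s_0\in S$, $\Sigma$ a set of actions, ${\rightarrow}\subseteq S\times\Sigma\times\mathcal D(S)$ (written $s\xrightarrow{a}\mu$), and every state has at least one outgoing transition. Fix a finite set $\mathcal F$ of fault labels with $\mathcal F\cap\Sigma=\emptyset$, $\Sigma_{\mathcal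 F}=\Sigma\cup\mathcal F$; for a set $X$ of labels, $X^i=\{e^i\mid e\in X\}$ (superscript-indexed copies). Masking simulation: for $A=(S,\Sigma,\rightarrow,s_0)$ (nominal) and $A'=(S',\Sigma_{\mathcal F},\rightarrow',s_0')$ (implementation), $A\preceq_m A'$ iff there is $\mathbf M\subseteq S\times S'$ with $s_0\,\mathbf M\,s_0'$ such that whenever $s\,\mathbf M\,s'$, for all $e\in\Sigma$ and $F\in\mathcal F$: (1) if $s\xrightarrow{e}\mu$ then $s'\xrightarrow{e}{}'\mu'$ with $\mu\,\mathbf M^{\#}\mu'$ for some $\mu'$; (2) if $s'\xrightarrow{e}{}'\mu'$ then $s\xrightarrow{e}\mu$ with $\mu\,\mathbf M^{\#}\mu'$ for some $\mu$; (3) if $s'\xrightarrow{F}{}'\mu'$ then $\Delta_s\,\mathbf M^{\#}\mu'$. Stochastic games: a stochastic game graph is $(V,E,V_1,V_2,V_{\mathsf P},v_0,\delta)$ with $V$ partitioned into $V_1,V_2,V_{\mathsf P}$, $v_0\in V$, $E\subseteq V\times V$, and $\delta:V_{\mathsf P}\to\mathcal D(V)$ with $(v,v')\in E$ iff $v'\in\mathrm{Supp}(\delta(v))$ for $v\in V_{\mathsf P}$. $\mathit{Post}(v)=\{v'\mid (v,v')\in E\}$. A play is an infinite sequence $\omega_0\omega_1\cdots$ with $(\omega_k,\omega_{k+1})\in E$. A strategy for player $i$ maps each finite sequence $w\cdot v$ with $v\in V_i$ to a distribution supported in $\mathit{Post}(v)$. Given strategies $\pi_1,\pi_2$ and a vertex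 $v$, the outcome $\mathit{out}_v(\pi_1,\pi_2)$ is the set of plays from $v$ that at every vertex of $V_i$ move to a vertex in the support of $\pi_i$'s choice and at every vertex $u\in V_{\mathsf P}$ move to a vertex in $\mathrm{Supp}(\delta(u))$. A strategy $\pi_1$ is sure winning from $v$ for objective $\Phi$ (a set of plays) if $\mathit{out}_v(\pi_1,\pi_2)\subseteq\Phi$ for every strategy $\pi_2$ of the opponent. Stochastic masking game graph $\mathcal G_{A,A'}=(V^{\mathcal G},E^{\mathcal G},V^{\mathcal G}_{\mathsf R},V^{\mathcal G}_{\mathsf V},V^{\mathcal G}_{\mathsf P},v_0^{\mathcal G},\delta^{\mathcal G})$ (Refuter owns $V_{\mathsf R}$, Verifier owns $V_{\mathsf V}$; ''$-$'' means undefined component): $V^{\mathcal G}_{\mathsf R}=\{(s,-,s',-,-,-,\mathsf R)\mid s\in S,s'\in S'\}\cup\{v_{\mathrm{err}}\}$; $V^{\mathcal G}_{\mathsf V}=\{(s,\sigma^1,s',\mu,-,-,\mathsf V)\mid \sigma\in\Sigma, s\xrightarrow{\sigma}\mu\}\cup\{(s,\sigma^2,s',-,\mu',-,\mathsf V)\mid \sigma\in\Sigma_{\mathcal F}, s'\xrightarrow{\sigma}{}'\mu'\}$; $V^{\mathcal G}_{\mathsf P}=\{(s,-,s',\mu,\mu',w,\mathsf P)\mid \mu\in\mathcal D(S),\mu'\in\mathcal D(S'),w\in\Omega(\mu,\mu')\}$; $v_0^{\mathcal G}=(s_0,-,s_0',-,-,-,\mathsf R)$; $\delta^{\mathcal G}((s,-,s',\mu,\mu',w,\mathsf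 P))((t,-,t',-,-,-,\mathsf R))=w(t,t')$. $E^{\mathcal G}$ is the least set such that: if $s\xrightarrow{\sigma}\mu$ then $(s,-,s',-,-,-,\mathsf R)\to(s,\sigma^1,s',\mu,-,-,\mathsf V)$; if $s'\xrightarrow{\sigma}{}'\mu'$ then $(s,-,s',-,-,-,\mathsf R)\to(s,\sigma^2,s',-,\mu',-,\mathsf V)$; if $s'\xrightarrow{\sigma}{}'\mu'$ and $w\in\Omega(\mu,\mu')$ then $(s,\sigma^1,s',\mu,-,-,\mathsf V)\to(s,-,s',\mu,\mu',w,\mathsf P)$; if $\sigma\notin\mathcal F$, $s\xrightarrow{\sigma}\mu$ and $w\in\Omega(\mu,\mu')$ then $(s,\sigma^2,s',-,\mu',-,\mathsf V)\to(s,-,s',\mu,\mu',w,\mathsf P)$; if $F\in\mathcal F$ and $w\in\Omega(\Delta_s,\mu')$ then $(s,F^2,s',-,\mu',-,\mathsf V)\to(s,-,s',\Delta_s,\mu',w,\mathsf P)$; for $(s,-,s',\mu,\mu',w,\mathsf P)\in V^{\mathcal G}_{\mathsf P}$ and $(t,t')\in\mathrm{Supp}(w)$, $(s,-,s',\mu,\mu',w,\mathsf P)\to(t,-,t',-,-,-,\mathsf R)$; and any $v\in V^{\mathcal G}_{\mathsf V}\cup\{v_{\mathrm{err}}\}$ with no successor other than $v_{\mathrm{err}}$ gets an edge $v\to v_{\mathrm{err}}$. *)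

(* Defs.v *)
From HB Require Import structures.
From mathcomp Require Import all_boot all_order all_algebra.
From mathcomp Require Import boolp classical_sets functions reals ereal esum.

Set Implicit Arguments.
Unset Strict Implicit.
Unset Printing Implicit Defensive.

Import Order.TTheory GRing.Theory Num.Theory.
Local Open Scope classical_set_scope.
Local Open Scope ring_scope.

(* [T] need not be countable: the sum is the supremum of the finite partial
   sums, so a distribution has countable support in any case.  This matters for
   strategies, since the vertices of a masking game contain distributions. *)
Record distr (R : realType) (T : choiceType) := Distr {
  dval :> T -> R;
  dval_itv : forall x, 0 <= dval x <= 1;
  dval_sum1 : \esum_(x in [set: T]) (dval x)%:E = 1%E }.

Definition supp (R : realType) (T : choiceType) (mu : distr R T) : set T :=
  [set x | 0 < mu x].

Section Dirac.
Variables (R : realType) (T : choiceType) (s : T).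

Lemma dirac_itv x : 0 <= ((x == s)%:R : R) <= 1.
Proof. by case: eqP; rewrite ?lexx ?ler01. Qed.

Lemma dirac_sum1 : \esum_(x in [set: T]) ((x == s)%:R : R)%:E = 1%E.
Proof.
rewrite -[RHS](@esum_set1 R T s (fun=> 1%E)) ?lee01//.
rewrite [RHS]esum_mkcond; apply: eq_esum => x _.
by rewrite classical_sets.in_set1; case: (x == s).
Qed.

Definition dirac_distr : distr R T := Distr dirac_itv dirac_sum1.

End Dirac.

Section Coupling.
Variables (R : realType) (S S' : choiceType).

Definition coupling (mu : distr R S) (mu' : distr R S') :
    set (distr R (S * S')%type) :=
  [set w | (forall t, \esum_(t' in [set: S']) (w (t, t'))%:E = (mu t)%:E) /\
           (forall t', \esum_(t in [set: S]) (w (t, t'))%:E = (mu' t')%:E)].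

Definition rel_lift (M : S -> S' -> Prop) (mu : distr R S) (mu' : distr R S') :
    Prop :=
  exists2 w, coupling mu mu' w & forall t t', supp w (t, t') -> M t t'.

End Coupling.

Record pts (R : realType) (L : Type) := PTS {
  state : countType;
  trans : state -> L -> distr R state -> Prop;
  start : state;
  trans_total : forall s, exists a mu, trans s a mu }.

(* The labels of the implementation, [Act + F], form the disjoint union of the
   actions and the faults. *)
Section MaskingSimulation.
Variables (R : realType) (Act : Type) (F : finType).
Variables (A : pts R Act) (A' : pts R (Act + F)%type).

Definition masking_simulation (M : state A -> state A' -> Prop) : Prop :=
  M (start A) (start A') /\
  forall s s', M s s' ->
    [/\ forall (e : Act) mu, trans s e mu ->
          exists2 mu', trans s' (inl e) mu' & rel_lift M mu mu',
        forall (e : Act) mu', trans s' (inl e) mu' ->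
          exists2 mu, trans s e mu & rel_lift M mu mu'
      & forall (f : F) mu', trans s' (inr f) mu' ->
          rel_lift M (dirac_distr R s) mu'].

Definition masked_by : Prop := exists M, masking_simulation M.

End MaskingSimulation.

Inductive player := Player1 | Player2.

Definition opponent (i : player) : player :=
  if i is Player1 then Player2 else Player1.

(* [owner] encodes the partition of the vertices: V_i is the set of [v] with
   [owner v = Some i], and V_P is the set of [v] with [owner v = None]. *)
Record game_graph (R : realType) := GameGraph {
  vertex : choiceType;
  owner : vertex -> option player;
  edge : vertex -> vertex -> Prop;
  v_init : vertex;
  delta : forall v, owner v = None -> distr R vertex;
  delta_edge : forall v (vP : owner v = None) v',
    edge v v' <-> supp (delta vP) v' }.

Section Strategies.
Variables (R : realType) (G : game_graph R).
Local Notation V := (vertex G).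

Definition post (v : V) : set V := [set v' | edge v v'].

Definition play (omega : nat -> V) : Prop :=
  forall k, edge (omega k) (omega k.+1).

(* [decide h v vi] is the value of the strategy on the sequence [h] followed by
   [v]. *)
Record strategy (i : player) := Strategy {
  decide :> seq V -> forall v : V, owner v = Some i -> distr R V;
  decide_post : forall h v (vi : owner v = Some i),
    supp (decide h vi) `<=` post v }.

Definition outcome (i : player) (pi : strategy i) (pi' : strategy (opponent i))
    (v : V) : set (nat -> V) :=
  [set omega | [/\ play omega, omega 0%N = v & forall k,
    [/\ forall vi : owner (omega k) = Some i,
          supp (pi (mkseq omega k) (omega k) vi) (omega k.+1),
        forall vi : owner (omega k) = Some (opponent i),
          supp (pi' (mkseq omega k) (omega k) vi) (omega k.+1)
      & forall vP : owner (omega k) = None,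
          supp (delta vP) (omega k.+1)]]].

Definition sure_winning (i : player) (pi : strategy i) (v : V)
    (Phi : set (nat -> V)) : Prop :=
  forall pi' : strategy (opponent i), outcome pi pi' v `<=` Phi.

Definition never (u : V) : set (nat -> V) :=
  [set omega | play omega /\ forall k, omega k <> u].

End Strategies.

Notation Refuter := Player1.
Notation Verifier := Player2.

Section MaskingGame.
Variables (R : realType) (Act : Type) (F : finType).
Variables (A : pts R Act) (A' : pts R (Act + F)%type).

(* The tuples of the masking game, without their undefined components;
   [VVert1] carries the label sigma^1 and [VVert2] the label sigma^2.  A vertex
   includes the (irrelevant) proof of the condition on its components, so that
   the inhabitants are exactly the vertices of the game. *)
Inductive mvertex :=
| RVert of state A & state A'
| ErrVert
| VVert1 (s : state A) (a : Act) (s' : state A') (mu : distr R (state A))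
    of trans s a mu
| VVert2 (s : state A) (a : Act + F) (s' : state A') (mu' : distr R (state A'))
    of trans s' a mu'
| PVert (s : state A) (s' : state A')
    (mu : distr R (state A)) (mu' : distr R (state A'))
    (w : distr R (state A * state A')%type) of coupling mu mu' w.

HB.instance Definition _ := gen_eqMixin mvertex.
HB.instance Definition _ := gen_choiceMixin mvertex.

Definition mowner (v : mvertex) : option player :=
  match v with
  | RVert _ _ | ErrVert => Some Refuter
  | VVert1 _ _ _ _ _ | VVert2 _ _ _ _ _ => Some Verifier
  | PVert _ _ _ _ _ _ => None
  end.

Inductive mstep : mvertex -> mvertex -> Prop :=
| step_R1 s s' a mu (tr : trans s a mu) :
    mstep (RVert s s') (VVert1 s' tr)
| step_R2 s s' a mu' (tr' : trans s' a mu') :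
    mstep (RVert s s') (VVert2 s tr')
| step_V1 s s' a mu mu' w (tr : trans s a mu) (cw : coupling mu mu' w) :
    trans s' (inl a) mu' ->
    mstep (VVert1 s' tr) (PVert s s' cw)
| step_V2 s s' (a : Act) mu mu' w (tr' : trans s' (inl a) mu')
    (cw : coupling mu mu' w) :
    trans s a mu ->
    mstep (VVert2 s tr') (PVert s s' cw)
| step_VF s s' (f : F) mu' w (tr' : trans s' (inr f) mu')
    (cw : coupling (dirac_distr R s) mu' w) :
    mstep (VVert2 s tr') (PVert s s' cw)
| step_P s s' mu mu' w (cw : coupling mu mu' w) t t' :
    supp w (t, t') ->
    mstep (PVert s s' cw) (RVert t t').

Definition medge (v v' : mvertex) : Prop :=
  mstep v v' \/
  [/\ v' = ErrVert, mowner v = Some Verifier \/ v = ErrVert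
    & forall u, mstep v u -> u = ErrVert].

Section Delta.
Variable w : distr R (state A * state A')%type.

Definition mdelta_val (v : mvertex) : R :=
  if v is RVert t t' then w (t, t') else 0.

Lemma mdelta_itv v : 0 <= mdelta_val v <= 1.
Proof. by case: v => *; rewrite /= ?lexx ?ler01//; apply: dval_itv. Qed.

Lemma mdelta_sum1 : \esum_(v in [set: mvertex]) (mdelta_val v)%:E = 1%E.
Proof.
pose e (p : state A * state A') := RVert p.1 p.2.
rewrite -(dval_sum1 w).
have -> : \esum_(p in [set: state A * state A']) (w p)%:E =
          \esum_(p in [set: state A * state A']) (mdelta_val (e p))%:E.
  by apply: eq_esum => -[t t'] _.
rewrite -(@esum_image _ _ _ [set: _] e (fun v => (mdelta_val v)%:E)); last first.
- by move=> [t t'] [u u'] _ _ [-> ->].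
rewrite [RHS]esum_mkcond; apply: eq_esum => v _.
case: ifPn => // /negP nv; case: v nv => // t t' []; rewrite inE.
by exists (t, t').
Qed.

Definition mdelta_distr : distr R mvertex := Distr mdelta_itv mdelta_sum1.

End Delta.

Definition mdelta (v : mvertex) : mowner v = None -> distr R mvertex :=
  match v with
  | PVert _ _ _ _ w _ => fun=> mdelta_distr w
  | _ => fun vP => ltac:(discriminate vP)
  end.

Lemma mdelta_edge v (vP : mowner v = None) v' :
  medge v v' <-> supp (mdelta vP) v'.
Proof.
case: v vP => // s s' mu mu' w cw vP; rewrite /supp /=; split.
- case=> [st|[_ [//|//]]].
  by inversion st.
- case: v' => [t t'||????? |????? |?????? ] /=; rewrite ?ltxx// => wt.
  by left; apply: step_P.
Qed.

Definition masking_game : game_graph R :=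
  GameGraph (RVert (start A) (start A')) mdelta_edge.

Definition v_err : vertex masking_game := ErrVert.

End MaskingGame.

Arguments v_err {R Act F} A A'.

(* Main.v *)
Require Import Defs.
From mathcomp Require Import all_boot all_order all_algebra.
From mathcomp Require Import boolp classical_sets reals ereal esum.

Set Implicit Arguments.
Unset Strict Implicit.
Unset Printing Implicit Defensive.

Import Order.TTheory GRing.Theory Num.Theory.

(** From a masking simulation M, the Verifier wins with a memoryless strategy:
    keep the pair of states in M, by always answering with a coupling supported
    in M.  Conversely, a sure winning strategy may use memory, so one lets M be
    the set of pairs (s, s') reached after some finite history consistent with
    the strategy.  No such history ends in the error vertex, because the game
    has no dead ends and a Refuter strategy can follow any given play; hence
    each answer of the Verifier is a coupling, whose support lies in M. *)

Lemma supp_nonempty (R : realType) (T : choiceType) (mu : distr R T) :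
  exists x, supp mu x.
Proof.
apply: contrapT => /forallNP mu0.
have := dval_sum1 mu; rewrite esum1 => [|x _]; last first.
  have /andP[mu_ge0 _] := dval_itv mu x.
  by congr (_%:E)%E; apply/eqP; rewrite eq_le mu_ge0 andbT leNgt; apply/negP/mu0.
by move/eqP; rewrite eqe eq_sym oner_eq0.
Qed.

Lemma supp_dirac (R : realType) (T : choiceType) (s : T) :
  supp (dirac_distr R s) = [set s]%classic.
Proof.
apply/seteqP; split=> x; rewrite /supp /=; first by case: eqP; rewrite ?ltxx.
by move=> ->; rewrite eqxx ltr01.
Qed.

(** * Stochastic games: histories compatible with a strategy *)

Section Game.
Variables (R : realType) (G : game_graph R).
Local Notation V := (vertex G).

Section DiracStrategy.
Variables (i : player) (next : seq V -> V -> V).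
Hypothesis next_edge : forall h v, owner v = Some i -> edge v (next h v).

Lemma dirac_strategy_post h v (vi : owner v = Some i) :
  subset (supp (dirac_distr R (next h v))) (post v).
Proof. by rewrite supp_dirac => _ ->; apply: next_edge vi. Qed.

Definition dirac_strategy : strategy G i :=
  Strategy (decide := fun h v _ => dirac_distr R (next h v))
    dirac_strategy_post.

End DiracStrategy.

Hypothesis no_dead_end : forall v : V, exists v', edge v v'.
Variables (i : player) (pi : strategy G i) (v0 : V).

(** Away from the vertices of player [i] any edge is allowed: the opponent is arbitrary, and the
    edges out of a probabilistic vertex are the support of [delta]. *)
Definition compatible_step (h : seq V) (v v' : V) : Prop :=
  edge v v' /\ forall vi : owner v = Some i, supp (pi h v vi) v'.

Inductive compatible : seq V -> V -> Prop :=
| compatible0 : compatible [::] v0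
| compatibleS h v v' : compatible h v -> compatible_step h v v' ->
    compatible (rcons h v) v'.

Lemma compatible_step_total h v : exists v', compatible_step h v v'.
Proof.
have [vi|nvi] := pselect (owner v = Some i).
  have [v' v'P] := supp_nonempty (pi h v vi); exists v'; split.
    exact: decide_post v'P.
  by move=> vi'; rewrite (Prop_irrelevance vi' vi).
by have [v' v'P] := no_dead_end v; exists v'; split.
Qed.

(** Passes from lists to functions on positions, the form that [outcome] uses; the values of [t]
    beyond [size h] are arbitrary. *)
Lemma compatible_prefix h v : compatible h v ->
  exists t : nat -> V, [/\ t 0%N = v0, t (size h) = v, mkseq t (size h) = h
    & forall k, (k < size h)%N -> compatible_step (mkseq t k) (t k) (t k.+1)].
Proof.
elim=> [|{}h u v' _ [t [t0 tu th tP]] uv']; first by exists (fun=> v0).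
pose t' k := if (k <= size h)%N then t k else v'.
have t'E k : (k <= size h)%N -> t' k = t k by rewrite /t' => ->.
have mkE k : (k <= size h)%N -> mkseq t' k = mkseq t k.
  move=> kh; apply/eq_in_map => j; rewrite mem_iota /= add0n => /ltnW jk.
  by rewrite t'E// (leq_trans jk).
have t'S : t' (size h).+1 = v' by rewrite /t' ltnn.
exists t'; rewrite size_rcons; split.
- by rewrite t'E.
- exact: t'S.
- by rewrite mkseqS mkE// th t'E// tu.
- move=> k; rewrite ltnS leq_eqVlt => /predU1P[->|kh].
    by rewrite mkE// t'S t'E// tu th.
  by rewrite mkE ?(ltnW kh)// !t'E ?(ltnW kh)//; apply: tP.
Qed.

Lemma compatible_play h v : compatible h v ->
  exists omega : nat -> V, [/\ omega 0%N = v0, omega (size h) = v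
    & forall k, compatible_step (mkseq omega k) (omega k) (omega k.+1)].
Proof.
move=> /compatible_prefix[t [t0 tv _ tP]].
have /choice[nx nxP] (p : seq V * V) : exists v', compatible_step p.1 p.2 v'.
  exact: compatible_step_total.
(* Here [p] is a history with its current vertex. Follow [t] whenever its next vertex is a
   compatible step, as it is along [h]; otherwise take any compatible step. *)
pose next (p : seq V * V) :=
  if pselect (compatible_step p.1 p.2 (t (size p.1).+1))
  then t (size p.1).+1 else nx p.
have nextP p : compatible_step p.1 p.2 (next p).
  by rewrite /next; case: pselect.
pose state_at n := iter n (fun p => (rcons p.1 p.2, next p)) ([::], v0).
pose omega n := (state_at n).2.
have histE n : (state_at n).1 = mkseq omega n.
  by elim: n => // n IHn; rewrite mkseqS -IHn.
have omegaS n : omega n.+1 = next (mkseq omega n, omega n).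
  by rewrite -histE /omega /= -surjective_pairing.
have omegaP k : compatible_step (mkseq omega k) (omega k) (omega k.+1).
  by rewrite omegaS; apply: (nextP (_, _)).
exists omega; split=> //.
(* Agreement is proved for all [k <= n] at once, because [next] depends on the whole history. *)
have omegaE n : (n <= size h)%N -> forall k, (k <= n)%N -> omega k = t k.
  elim: n => [_ k|n IHn nh k]; first by rewrite leqn0 => /eqP ->.
  rewrite leq_eqVlt => /predU1P[->|/IHn]; last by apply; apply: ltnW.
  have mkE : mkseq omega n = mkseq t n.
    apply/eq_in_map => j; rewrite mem_iota /= add0n => /ltnW jn.
    by rewrite (IHn (ltnW nh)).
  rewrite omegaS mkE (IHn (ltnW nh))// /next /= size_mkseq.
  by case: pselect => // -[]; apply: tP.
by rewrite (omegaE _ (leqnn _)).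
Qed.

Lemma compatible_outcome (omega : nat -> V) : omega 0%N = v0 ->
  (forall k, compatible_step (mkseq omega k) (omega k) (omega k.+1)) ->
  exists pi' : strategy G (opponent i), outcome pi pi' v0 omega.
Proof.
move=> omega0 omegaP; have [nx nxP] := choice no_dead_end.
(* The opponent reads its position in [omega] off the length of the history; [nx] serves where
   moving along [omega] is not an edge. *)
pose next (h : seq V) v :=
  if pselect (edge v (omega (size h).+1)) then omega (size h).+1 else nx v.
have next_edge h v : owner v = Some (opponent i) -> edge v (next h v).
  by move=> _; rewrite /next; case: pselect.
exists (dirac_strategy next_edge); split=> // [k|k].
  by have [] := omegaP k.
have [ek pik] := omegaP k; split=> //= [_|vP]; last exact/delta_edge.
by rewrite supp_dirac /next size_mkseq /=; case: pselect.
Qed.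

Lemma sure_winning_compatible u h v :
  sure_winning pi v0 (never u) -> compatible h v -> v <> u.
Proof.
move=> win /compatible_play[omega [omega0 <- /(compatible_outcome omega0)]].
by move=> [pi' /win[_]].
Qed.

End Game.

(** * The masking game: shape of its moves and absence of dead ends *)

Section Masking.
Variables (R : realType) (Act : Type) (F : finType).
Variables (A : pts R Act) (A' : pts R (Act + F)%type).
Local Notation G := (masking_game A A').

(** Stated as a match so that one case analysis on [v'] discards the impossible successors and
    leaves equalities of components, not of the proofs that vertices carry. *)
Lemma mstep_inv (v v' : mvertex A A') : mstep v v' ->
  match v, v' with
  | RVert s s', VVert1 t _ t' _ _ => t = s /\ t' = s'
  | RVert s s', VVert2 t _ t' _ _ => t = s /\ t' = s'
  | VVert1 s a s' mu _, PVert _ _ nu nu' _ _ =>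
      nu = mu /\ trans s' (inl a) nu'
  | VVert2 s (inl a) s' mu' _, PVert _ _ nu nu' _ _ =>
      nu' = mu' /\ trans s a nu
  | VVert2 s (inr _) s' mu' _, PVert _ _ nu nu' _ _ =>
      nu' = mu' /\ nu = dirac_distr R s
  | PVert _ _ _ _ w _, RVert t t' => supp w (t, t')
  | _, _ => False
  end.
Proof. by case. Qed.

(** Pairs of states move because transitions of [A] are total, probabilistic vertices because a
    coupling has nonempty support; the others can fall back on the error edge. *)
Lemma masking_no_dead_end (v : vertex G) : exists v', edge v v'.
Proof.
have [[v' vv']|nstep] := pselect (exists v', mstep v v').
  by exists v'; left.
have stuck u : mstep v u -> u = v_err A A' by move=> vu; case: nstep; exists u.
case: v nstep stuck => [s s'||s a s' mu tr|s a s' mu' tr|s s' mu mu' w cw].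
- have [a [mu tr]] := trans_total s; case; exists (VVert1 s' tr).
  exact: step_R1.
- by exists (v_err A A'); right; split=> //; right.
- by exists (v_err A A'); right; split=> //; left.
- by exists (v_err A A'); right; split=> //; left.
- have [[t t'] wt] := supp_nonempty w; case; exists (RVert t t').
  exact: step_P.
Qed.

(** * From a masking simulation to a sure winning strategy *)

Section SimulationToStrategy.
Variable M : state A -> state A' -> Prop.
Hypothesis simM : masking_simulation M.

(** The invariant of plays won by answering within [M]. At a probabilistic vertex it constrains the
    whole support, since chance may pick any pair in it. *)
Definition safe (v : mvertex A A') : Prop :=
  match v with
  | RVert s s' | VVert1 s _ s' _ _ | VVert2 s _ s' _ _ => M s s'
  | PVert _ _ _ _ w _ => forall t t', supp w (t, t') -> M t t'
  | ErrVert => False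
  end.

Lemma safe_edge (v v' : vertex G) : owner v <> Some Verifier ->
  safe v -> edge v v' -> safe v'.
Proof.
move=> vV sv [/mstep_inv|[_ [//|v_err0]]]; last by rewrite v_err0 in sv.
case: v vV sv => [s s'||s a s' mu tr|s a s' mu' tr|s s' mu mu' w cw] //= _.
  by case: v' => //= [t a t' mu tr|t a t' mu tr] Ms [-> ->].
by case: v' => //= t t'; apply.
Qed.

(** The three clauses of masking simulation match the three kinds of Verifier move; the coupling
    inside [rel_lift] is the answer. *)
Lemma safe_answer (v : vertex G) : owner v = Some Verifier -> safe v ->
  exists2 v', edge v v' & safe v'.
Proof.
have [_ sim] := simM.
case: v => [s s'||s a s' mu tr|s a s' mu' tr|s s' mu mu' w cw] //= _.
  move=> /sim[/(_ _ _ tr)[mu' tr' [w cw wM]] _ _].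
  by exists (PVert s s' cw) => //; left; apply: step_V1.
move=> /sim[_ simA simF]; case: a tr => [a|f] tr.
  have [mu tr' [w cw wM]] := simA _ _ tr.
  by exists (PVert s s' cw) => //; left; apply: step_V2.
have [w cw wM] := simF _ _ tr.
by exists (PVert s s' cw) => //; left; apply: step_VF.
Qed.

Lemma simulation_sure_winning :
  exists pi : strategy G Verifier, sure_winning pi (v_init G) (never (v_err A A')).
Proof.
(* A strategy must also be defined at unsafe vertices; there any successor will do. *)
have /choice[nx nxP] (v : vertex G) :
    exists v', edge v v' /\ (owner v = Some Verifier -> safe v -> safe v').
  have [[vV sv]|nsv] := pselect (owner v = Some Verifier /\ safe v).
    by have [v' vv' sv'] := safe_answer vV sv; exists v'.
  have [v' vv'] := masking_no_dead_end v; exists v'; split=> // vV sv.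
  by case: nsv.
pose next (h : seq (vertex G)) v := nx v.
have next_edge h v : owner v = Some Verifier -> edge v (next h v).
  by move=> _; have [] := nxP v.
exists (dirac_strategy next_edge) => pi' omega [omega_play omega0 omegaP].
split=> // k; suff : safe (omega k) by move=> /[swap] ->.
elim: k => [|k IHk]; first by rewrite omega0; case: simM.
have [vV|nvV] := pselect (owner (omega k) = Some Verifier).
  have [/(_ vV) + _ _] := omegaP k.
  by rewrite /= supp_dirac => ->; have [_] := nxP (omega k); apply.
exact: safe_edge nvV IHk (omega_play k).
Qed.

End SimulationToStrategy.

(** * From a sure winning strategy to a masking simulation *)

Section StrategyToSimulation.
Variable pi : strategy G Verifier.
Hypothesis win : sure_winning pi (v_init G) (never (v_err A A')).

Local Notation consistent := (compatible pi (v_init G)).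

Definition reached (s : state A) (s' : state A') : Prop :=
  exists h, consistent h (RVert s s').

Lemma consistent_R h s s' (v : vertex G) : consistent h (RVert s s') ->
  mstep (RVert s s') v -> consistent (rcons h (RVert s s')) v.
Proof. by move=> hs sv; apply: compatibleS hs _; split; first left. Qed.

Lemma consistent_P h s s' mu mu' w (cw : coupling mu mu' w) :
  consistent h (PVert s s' cw) -> forall t t', supp w (t, t') -> reached t t'.
Proof.
move=> hP t t' wt; exists (rcons h (PVert s s' cw)).
by apply: compatibleS hP _; split=> //; left; apply: step_P.
Qed.

(** Some compatible step leaves [v], and it avoids the error vertex because [pi] wins, so it is an
    [mstep]. *)
Lemma consistent_V h (v : vertex G) : consistent h v ->
  exists h' v', consistent h' v' /\ mstep v v'.
Proof.
move=> hv; have [v' vv'] := compatible_step_total masking_no_dead_end pi h v.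
have hv' := compatibleS hv vv'; exists (rcons h v), v'; split=> //.
have v'_err := sure_winning_compatible masking_no_dead_end win hv'.
by case: vv' => -[//|[/v'_err]].
Qed.

Lemma reached_simulation : masking_simulation reached.
Proof.
split; first by exists [::]; apply: compatible0.
move=> s s' [h hs]; split=> [e mu tr|e mu' tr|f mu' tr].
(* The transition to match is played as a Refuter move. The answer is a probabilistic vertex whose
   coupling is the witness; [consistent_P] puts its support in [reached]. *)
- have /consistent_V[h' [v' [hv' /mstep_inv]]] :=
    consistent_R hs (step_R1 s' tr).
  case: v' hv' => //= t t' nu nu' w cw /consistent_P wM [numu tr'].
  by exists nu' => //; exists w => //; rewrite -numu.
- have /consistent_V[h' [v' [hv' /mstep_inv]]] :=
    consistent_R hs (step_R2 s tr).
  case: v' hv' => //= t t' nu nu' w cw /consistent_P wM [numu tr'].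
  by exists nu => //; exists w => //; rewrite -numu.
- have /consistent_V[h' [v' [hv' /mstep_inv]]] :=
    consistent_R hs (step_R2 s tr).
  case: v' hv' => //= t t' nu nu' w cw /consistent_P wM [numu nus].
  by exists w => //; rewrite -numu -nus.
Qed.

End StrategyToSimulation.

End Masking.

Theorem theorem1 (R : realType) (Act : Type) (F : finType)
    (A : pts R Act) (A' : pts R (Act + F)%type) :
  masked_by A A' <->
  exists pi : strategy (masking_game A A') Verifier,
    sure_winning pi (v_init (masking_game A A')) (never (v_err A A')).
Proof.
split=> [[M simM]|[pi win]]; first exact: simulation_sure_winning simM.
by exists (reached pi); apply: reached_simulation.
Qed.
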